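(* Let $T\in(0,\infty)$, let $\Omega=C([0,T],\mathbb{R})$, let $W$ be the coordinate process on $\Omega$, let $\mathsf{P}$ be the Wiener measure, let $(\mathcal{F}_t)_{t\in[0,T]}$ be the filtration generated by $W$ and augmented to satisfy the usual conditions, and let $\mathcal{F}=\mathcal{F}_T$. Take the progressively measurable functional $\xi\equiv 0$, so that the process $X(t)=\xi(W(\cdot),t)$ is identically $0$. For $\lambda\in\mathbb{R}$ let $\mathsf{P}^\lambda$ be the measure on $(\Omega,\mathcal{F})$ with $$\frac{d\mathsf{P}^\lambda}{d\mathsf{P}}=\exp\left\{\lambda W(T)-\frac{\lambda^2}{2}T\right\}.$$ Then for every $\lambda\in\mathbb{R}$ the measure $\mathsf{P}^\lambda$ is a candidate measure corresponding to $X$, with associated $(\mathcal{F}_t,\mathsf{P}^\lambda)$-Brownian motion $W^\lambda(t)=W(t)-\lambda t$, $t\in[0,T]$. In particular, the candidate measure corresponding to $X$ is not unique.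
   Context: Let $X(t)=\xi(W(\cdot),t)$, $t\in[0,T]$, be a progressively measurable process on $(\Omega,\mathcal{F},(\mathcal{F}_t)_{t\in[0,T]},\mathsf{P})$, where $\xi$ is a progressively measurable functional. A candidate measure corresponding to $X$ is a probability measure $\mathsf{Q}^C$ on $(\Omega,\mathcal{F})$ for which there is a $\mathsf{Q}^C$-Brownian motion $W^{\mathsf{Q}^C}$ such that $$X(t)=\xi\left(W^{\mathsf{Q}^C}(\cdot)+\int_0^{\cdot}X(u)\,du,\;t\right)$$ holds (possibly only up to the explosion time $\tau^{M_X}=\lim_{N\to\infty}\inf\{t:\int_0^t|X(u)|^2\,du\ge N\}$, which is $\infty$ when $X\equiv0$). *)

(* Defs.v *)
From HB Require Import structures.
From mathcomp Require Import all_boot all_order all_algebra.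
From mathcomp Require Import all_classical all_reals all_analysis.
From mathcomp Require Import measurable_realfun.

Set Implicit Arguments.
Unset Strict Implicit.
Unset Printing Implicit Defensive.

Import Order.TTheory GRing.Theory Num.Theory.
Import numFieldNormedType.Exports.

Local Open Scope classical_set_scope.
Local Open Scope ring_scope.

(* C([0,T], R); the interval is a type, with the topology induced by R. *)
Definition path_space (R : realType) (T : R) : Type :=
  continuousType (`[0, T]%classic : set R) R.

HB.instance Definition _ (R : realType) (T : R) := Choice.on (path_space T).
HB.instance Definition _ (R : realType) (T : R) :=
  isPointed.Build (path_space T) (@cst (`[0, T]%classic : set R) R 0).

(* Processes are indexed by R, and only their values at the times of [0, T]
   matter; the coordinate process is set to 0 at the other times. *)
Definition coordinate (R : realType) (T : R) (t : R) (w : path_space T) : R :=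
  oapp (w : (`[0, T]%classic : set R) -> R) 0 (insub t).

Definition cylinders (R : realType) (T t : R) : set_system (path_space T) :=
  [set A | exists2 s, 0 <= s <= t &
           exists2 V : set R, measurable V & A = coordinate s @^-1` V].
Arguments cylinders {R} T t _.

Definition raw_filtration (R : realType) (T t : R) :
  set_system (path_space T) := <<s cylinders T t >>.
Arguments raw_filtration {R} T t _.

(* Omega with the sigma-algebra generated by the whole coordinate process. *)
Definition raw_space (R : realType) (T : R) : Type :=
  g_sigma_algebraType (cylinders T T).

HB.instance Definition _ (R : realType) (T : R) :=
  Measurable.on (raw_space T).

(* For t < T this is the intersection over s > t of the completed raw
   sigma-algebras at time s; for t = T only s = T occurs. *)
Definition augmented_filtration (R : realType) (T : R)
    (P0 : set (raw_space T) -> \bar R) (t : R) : set_system (path_space T) :=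
  \bigcap_(s in [set s | t < s <= T \/ s = T])
    <<s raw_filtration T s `|` P0.-negligible >>.
Arguments augmented_filtration {R T} P0 t _.

(* Omega with the sigma-algebra F = F_T. *)
Definition augmented_space (R : realType) (T : R)
    (P0 : set (raw_space T) -> \bar R) : Type :=
  g_sigma_algebraType (augmented_filtration P0 T).

HB.instance Definition _ (R : realType) (T : R)
    (P0 : set (raw_space T) -> \bar R) := Measurable.on (augmented_space P0).

Section augmented_measure.
Context (R : realType) (T : R) (P0 : probability (raw_space T) R).

(* The unique extension of P0 to F: the outer measure of P0, restricted. *)
Definition augmented_measure : set (augmented_space P0) -> \bar R :=
  (P0^*)%mu.

Let caratheodory_augmented (A : set (augmented_space P0)) :
  measurable A -> ((P0^*)%mu).-cara.-measurable A.
Proof.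
have sa : sigma_algebra [set: path_space T] ((P0^*)%mu).-cara.-measurable.
  exact: sigma_algebra_measurable.
apply: smallest_sub => // {}A /(_ T); apply; first by right.
split=> // B [|[N [mN N0 BN]]].
- by move=> mB; apply: (@caratheodory_measurable_mu_ext _ _ (raw_space T)).
- apply: (@measure_is_complete_caratheodory R (raw_space T) ((P0^*)%mu)).
  exists N; split => //.
  + exact: caratheodory_measurable_mu_ext.
  + by rewrite -N0; apply: (@measurable_mu_extE _ _ (raw_space T)).
Qed.

Let augmented_measure0 : augmented_measure set0 = 0%E.
Proof. exact: mu_ext0. Qed.

Let augmented_measure_ge0 A : (0 <= augmented_measure A)%E.
Proof. exact: mu_ext_ge0. Qed.

Let augmented_measure_semi_sigma_additive :
  semi_sigma_additive augmented_measure.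
Proof.
move=> F mF tF mUF.
apply: (@caratheodory_measure_sigma_additive R (raw_space T) (P0^*)%mu) => //.
- by move=> i; exact: caratheodory_augmented.
- exact: caratheodory_augmented.
Qed.

HB.instance Definition _ := isMeasure.Build _ _ _ augmented_measure
  augmented_measure0 augmented_measure_ge0
  augmented_measure_semi_sigma_additive.

Let augmented_measure_setT : augmented_measure setT = 1%E.
Proof.
rewrite -(probability_setT P0).
by apply: (@measurable_mu_extE _ _ (raw_space T)); exact: measurableT.
Qed.

HB.instance Definition _ := Measure_isProbability.Build _ _ _ augmented_measure
  augmented_measure_setT.

End augmented_measure.

Section brownian_motion.
Local Open Scope ereal_scope.

Definition brownian_motion (R : realType) (T : R) d (Om : measurableType d)
    (F : R -> set_system Om) (Q : {measure set Om -> \bar R})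
    (B : R -> Om -> R) : Prop :=
  [/\ forall t (V : set R), (0 <= t <= T)%R -> measurable V ->
        F t (B t @^-1` V),
      {ae Q, forall w, B 0%R w = 0%R},
      {ae Q, forall w, {within `[0%R, T], continuous (B ^~ w)}},
      forall s t A (V : set R), (0 <= s < t)%R -> (t <= T)%R ->
        F s A -> measurable V ->
        Q (A `&` (B t \- B s)%R @^-1` V) = Q A * Q ((B t \- B s)%R @^-1` V) &
      forall s t (V : set R), (0 <= s < t)%R -> (t <= T)%R -> measurable V ->
        Q ((B t \- B s)%R @^-1` V) = normal_prob 0 (Num.sqrt (t - s)) V].

End brownian_motion.

(* The Wiener measure is characterized by the coordinate process being a
   Brownian motion; its existence is not available in the library. *)
Definition wiener_measure (R : realType) (T : R)
    (P0 : probability (raw_space T) R) : Prop :=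
  @brownian_motion R T _ (raw_space T) (raw_filtration T) P0 (@coordinate R T).

(* On [0, t], measurability with respect to F^0_t (x) Borel([0, t]). *)
Definition progressive_functional (R : realType) (T : R)
    (xi : path_space T -> R -> R) : Prop :=
  forall t, 0 <= t <= T ->
    measurable_fun
      [set p : g_sigma_algebraType (cylinders T t) * R | 0 <= p.2 <= t]
      (fun p => xi p.1 p.2).

(* lim_N inf {t : \int_0^t |x(u)|^2 du >= N}, with inf set0 = +oo. *)
Definition explosion_time (R : realType) (T : R) (x : R -> R) : \bar R :=
  limn (fun N : nat => ereal_inf [set t%:E | t in [set t | 0 <= t <= T /\
    (N%:R%:E <= \int[lebesgue_measure]_(u in `[0%R, t]) (`|x u| ^+ 2)%:E)%E]]).

(* [B] is the Brownian motion W^Q of the candidate measure [Q] corresponding to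
   X(t) = xi(W, t). As [xi] is non-anticipating and the path
   W^Q + \int_0^. X(u) du need not make sense after the explosion time, at time
   [t] it is represented by a path [y] that agrees with it on [0, t]. *)
Definition candidate_measure_with (R : realType) (T : R)
    (P0 : probability (raw_space T) R) (xi : path_space T -> R -> R)
    (Q : {measure set (augmented_space P0) -> \bar R})
    (B : R -> path_space T -> R) : Prop :=
  let X t w := xi w t in
  [/\ Q setT = 1%E,
      @brownian_motion R T _ (augmented_space P0)
        (augmented_filtration P0) Q B &
      {ae Q, forall w, forall t, 0 <= t <= T ->
        (t%:E < explosion_time T (X ^~ w))%E ->
        exists y : path_space T,
          (forall s, 0 <= s <= t -> coordinate s y =
             B s w + \int[lebesgue_measure]_(u in `[0, s]) X u w) /\
          X t w = xi y t}].

Definition candidate_measure (R : realType) (T : R)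
    (P0 : probability (raw_space T) R) (xi : path_space T -> R -> R)
    (Q : {measure set (augmented_space P0) -> \bar R}) : Prop :=
  exists B, candidate_measure_with xi Q B.

Section tilted_measure.
Context (R : realType) (T : R) (P0 : probability (raw_space T) R) (lambda : R).

Definition tilting_density (w : path_space T) : R :=
  expR (lambda * coordinate T w - lambda ^+ 2 / 2 * T).

(* d(tilted_measure) / d(augmented_measure P0) = tilting_density *)
Definition tilted_measure : set (augmented_space P0) -> \bar R :=
  fun A => (\int[@augmented_measure R T P0]_(w in A) (tilting_density w)%:E)%E.

Let measurable_density :
  measurable_fun [set: augmented_space P0] (tilting_density : _ -> R).
Proof.
apply: measurableT_comp => //.
apply: measurable_funB => //; apply: measurable_funM => //.
have [T0|T0] := leP 0 T; last first.
  rewrite (_ : coordinate T = cst 0)//; apply/funext => w.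
  by rewrite /coordinate insubF// mem_setE in_itv/= lexx andbT leNgt T0.
move=> _ V mV; rewrite setTI; apply: sub_sigma_algebra => s [|->].
  by move=> /andP[Ts sT]; move: (lt_le_trans Ts sT); rewrite ltxx.
apply: sub_sigma_algebra; left; apply: sub_sigma_algebra.
by exists T; [rewrite T0 lexx|exists V].
Qed.

Let tilted_measure0 : tilted_measure set0 = 0%E.
Proof. exact: integral_set0. Qed.

Let tilted_measure_ge0 A : (0 <= tilted_measure A)%E.
Proof. by apply: integral_ge0 => w _; rewrite lee_fin expR_ge0. Qed.

Let tilted_measure_semi_sigma_additive : semi_sigma_additive tilted_measure.
Proof.
move=> F mF tF mUF; rewrite /tilted_measure ge0_integral_bigcup//.
- apply: is_cvg_nneseries => n _ _.
  exact: tilted_measure_ge0.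
- by apply/measurable_EFinP; exact: measurable_funTS.
- by move=> w _; rewrite lee_fin expR_ge0.
Qed.

HB.instance Definition _ := isMeasure.Build _ _ _ tilted_measure
  tilted_measure0 tilted_measure_ge0 tilted_measure_semi_sigma_additive.

End tilted_measure.

(* Main.v *)
From HB Require Import structures.
Require Import Defs.
From mathcomp Require Import all_boot all_order all_algebra.
From mathcomp Require Import all_classical all_reals all_analysis.
From mathcomp Require Import measurable_realfun.
From mathcomp Require Import ring lra.

Set Implicit Arguments.
Unset Strict Implicit.
Unset Printing Implicit Defensive.

Import Order.TTheory GRing.Theory Num.Theory.
Import numFieldNormedType.Exports.

Local Open Scope classical_set_scope.
Local Open Scope ring_scope.

(** Since xi vanishes, a candidate measure is any probability measure on F_T
    that carries a Brownian motion for the augmented filtration (F_t) and makes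
    the fixed-point identity meaningful.  That identity reads 0 = 0; all it asks
    for is a continuous path equal to B on [0, t], and W(w) - lambda id is one
    ([drifted_path]).  The content is thus Girsanov's theorem for the constant
    drift lambda: under dQ = exp(lambda W_T - lambda^2 T / 2) dP the process
    B_t = W_t - lambda t is a Brownian motion.

    The density factorizes as D_s * exp(lambda Z - lambda^2 (t - s) / 2) times
    a similar factor for the interval [t, T], where Z = W_t - W_s and
    D_s = exp(lambda W_s - lambda^2 s / 2).  Under P, Z is independent of F_s
    and has law N(0, t - s), so expectations of products split by Fubini
    ([ge0_integral_mul_indep]); and exponential tilting turns N(0, t - s) into
    its translate by lambda (t - s) ([integral_expR_normal_prob]).  Hence
    Q(A and B_t - B_s in V) = Q(A) N(0, t - s)(V) for A in F_s
    ([girsanov_increment]), which contains the total mass of Q, the law of the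
    increments and their independence of the past.

    The Wiener measure only gives independence of the increments from the raw
    filtration.  For the augmented one, sets of the completed raw
    sigma-algebras differ from raw sets by null sets, and the right limit is
    reached by letting s_n decrease to s: increments over [s_n, t] are
    independent of F_s, and path continuity passes this to the limit
    ([augmented_independence]).

    Two candidates are distinguished by the event W_T - W_0 >= T: its
    probability under P^lambda is N(0, T)([T - lambda T, +oo)), which increases
    strictly from lambda = 0 to lambda = 1. *)

(** * Gaussian laws on the line *)

Section normal_laws.
Local Open Scope ereal_scope.
Context {R : realType}.
Notation mu := (@lebesgue_measure R).

Lemma ge0_integral_normal_prob (m s : R) (g : R -> \bar R) (D : set R) :
  measurable D -> measurable_fun D g -> (forall x, 0 <= g x) ->
  \int[normal_prob m s]_(x in D) g x =
  \int[mu]_(x in D) (g x * (normal_pdf m s x)%:E).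
Proof.
move=> mD mg g0; have dom := normal_prob_dominates m s.
rewrite -(Radon_Nikodym_SigmaFinite.change_of_variables dom)//.
have int_f := Radon_Nikodym_SigmaFinite.f_integrable dom.
have mpdf : measurable_fun setT (fun x => (normal_pdf m s x)%:E).
  by apply/measurable_EFinP; exact: measurable_normal_pdf.
apply: ae_eq_integral => //.
- apply: emeasurable_funM => //; apply: measurable_funTS.
  exact: measurable_int int_f.
- by apply: emeasurable_funM => //; exact: measurable_funTS.
- apply: ae_eqe_mul2l; apply: integral_ae_eq => //.
  + exact: integrableS int_f.
  + exact: measurable_funTS.
  + by move=> E _ mE; rewrite -Radon_Nikodym_SigmaFinite.f_integral.
Qed.

(** Open right rays are stable under intersection and generate the Borel sets. *)
Lemma measure_ray_unique (m1 m2 : {measure set (measurableTypeR R) -> \bar R}) :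
  m1 setT < +oo ->
  (forall a : R, m1 `]a, +oo[%classic = m2 `]a, +oo[%classic) ->
  forall V, measurable V -> m1 V = m2 V.
Proof.
move=> m1oo m12 V mV; apply: (@measure_unique _ R (measurableTypeR R)
  (@RGenOInfty.G R) (fun n => `](- n%:R)%R, +oo[%classic)).
- exact: RGenOInfty.measurableE.
- move=> _ _ [x ->] [y ->]; exists (Num.max x y).
  by apply/seteqP; split => z /=; rewrite !in_itv/= !andbT gt_max => /andP.
- by move=> n; exists (- n%:R)%R.
- apply/seteqP; split => // z _; exists (Num.truncn `|z|).+1 => //=.
  rewrite in_itv/= andbT ltrNl (le_lt_trans (ler_norm _))// normrN.
  exact: truncnS_gt.
- by move=> _ [x ->]; exact: m12.
- by move=> n; apply: le_lt_trans m1oo; apply: le_measure; rewrite ?inE.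
- by [].
Qed.

(** On rays this is the change of variables x -> x + m in the integral of the
    density; a finite measure on the line is determined by its rays. *)
Lemma normal_prob_translation (m s : R) (V : set R) : s != 0%R ->
  measurable V ->
  normal_prob m s V = normal_prob 0 s ((fun x => x + m)%R @^-1` V).
Proof.
move=> s0 mV.
have mf : @measurable_fun _ _ (measurableTypeR R) (measurableTypeR R) setT
    (fun x : R => x + m)%R.
  exact: (@measurable_funD _ R).
pose mf_mixin := isMeasurableFun.Build _ _ _ _ _ mf.
pose f : {mfun measurableTypeR R >-> measurableTypeR R} :=
  HB.pack (fun x : R => x + m)%R mf_mixin.
pose nu := distribution (normal_prob 0 s : probability _ _) f.
rewrite -[RHS]/(nu V); apply: measure_ray_unique => // [|a].
  by have /= -> := probability_setT (normal_prob m s); rewrite ltry.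
rewrite /nu/= /distribution /pushforward/=.
have -> : (fun x : R => x + m)%R @^-1` `]a, +oo[ = `](a - m)%R, +oo[%classic.
  by apply/seteqP; split => x/=; rewrite !in_itv/= !andbT ltrBlDr.
have dF : (fun x : R => x + m)%R^`()%classic = cst (1%R : R).
  by apply/funext => x; rewrite derive1E deriveD// derive_id derive_cst addr0.
rewrite /normal_prob !integral_itv_obnd_cbnd; last 2 first.
- by apply/measurable_EFinP/measurable_funTS; exact: measurable_normal_pdf.
- by apply/measurable_EFinP/measurable_funTS; exact: measurable_normal_pdf.
rewrite -[in LHS](subrK m a).
rewrite (@increasing_ge0_integration_by_substitutiony _ (fun x => x + m)%R
  (normal_pdf m s) (a - m)%R).
- apply: eq_integral => x _ /=.
  rewrite dF fctE /= mulr1 !normal_pdfE//= /normal_fun.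
  by rewrite addrK subr0.
- by move=> x y _ _; rewrite ltrD2r.
- by rewrite dF => x _; exact: cst_continuous.
- by rewrite dF; exact: is_cvg_cst.
- by rewrite dF; exact: is_cvg_cst.
- split.
  + by move=> x _; exact: derivableD.
  + by apply: cvg_at_right_filter; apply: cvgD; [exact: cvg_id|exact: cvg_cst].
- exact: cvg_addrr.
- by apply: continuous_subspaceT; exact: continuous_normal_pdf.
- by move=> x _; exact: normal_pdf_ge0.
Qed.

(** Completing the square, l x - l^2 t / 2 - x^2 / (2 t) = - (x - l t)^2 / (2 t).
    So tilting N(0, t) by exp(l x - l^2 t / 2) gives N(l t, t), and
    subtracting the mean l t brings back N(0, t). *)
Lemma integral_expR_normal_prob (l t : R) (V : set R) : (0 < t)%R ->
  measurable V ->
  \int[normal_prob 0 (Num.sqrt t)]_(x in (fun x => x - l * t)%R @^-1` V)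
     (expR (l * x - l ^+ 2 / 2 * t))%:E =
  normal_prob 0 (Num.sqrt t) V.
Proof.
move=> t0 mV.
have s0 : Num.sqrt t != 0%R by rewrite gt_eqF// sqrtr_gt0.
have mV' : measurable ((fun x => x - l * t)%R @^-1` V).
  rewrite -[X in measurable X]setTI.
  exact: (measurable_funB (@measurable_id _ _ _) (@measurable_cst _ _ _ _ _ _)).
rewrite ge0_integral_normal_prob//; last first.
  apply/measurable_EFinP/measurable_funTS; apply: measurableT_comp => //.
  by apply: measurable_funB => //; exact: measurable_funM.
transitivity
  (normal_prob (l * t) (Num.sqrt t) ((fun x => x - l * t)%R @^-1` V)).
  apply: eq_integral => x _; rewrite -EFinM !normal_pdfE//.
  rewrite mulrCA /normal_fun -expRD; congr (_ * expR _)%:E.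
  rewrite sqr_sqrtr; last exact: ltW.
  by field; exact: lt0r_neq0.
rewrite normal_prob_translation//.
by congr (normal_prob _ _ _); apply/funext => x/=; rewrite addrK.
Qed.

Lemma normal_prob1 (m s a : R) : normal_prob m s [set a] = 0.
Proof.
have /null_content_dominatesP := normal_prob_dominates m s.
by apply => //; exact: lebesgue_measure_set1.
Qed.

(** A positive density cannot have a vanishing integral over an interval of
    positive length. *)
Lemma normal_prob_itv_gt0 (m s a b : R) : s != 0%R -> (a < b)%R ->
  0 < normal_prob m s `[a, b[.
Proof.
move=> s0 ab; rewrite lt0e measure_ge0 andbT; apply/eqP => N0.
have mpdf D : measurable_fun D (fun x => (normal_pdf m s x)%:E).
  by apply/measurable_funTS/measurable_EFinP; exact: measurable_normal_pdf.
have : ae_eq mu `[a, b[%classic (fun x => (normal_pdf m s x)%:E) (cst 0).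
  apply/(ae_eq_integral_abs mu) => //; first exact: mpdf.
  transitivity (normal_prob m s `[a, b[%classic); last exact: N0.
  apply: eq_integral => x _.
  by rewrite gee0_abs// lee_fin normal_pdf_ge0.
move=> pdf0; have : mu `[a, b[%classic = 0.
  apply/negligibleP => //; apply: negligibleS pdf0 => x xab /= /(_ xab)/eqP.
  apply/negP; rewrite eqe gt_eqF// normal_pdfE//.
  by rewrite mulr_gt0 ?expR_gt0// normal_peak_gt0.
rewrite lebesgue_measure_itv/= lte_fin ab -EFinD => /eqP.
by rewrite eqe subr_eq0 gt_eqF.
Qed.

Lemma normal_prob_ray_lt (m s a b : R) : s != 0%R -> (a < b)%R ->
  normal_prob m s `[b, +oo[ < normal_prob m s `[a, +oo[.
Proof.
move=> s0 ab.
have -> : `[a, +oo[%classic = `[a, b[%classic `|` `[b, +oo[%classic :> set R.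
  by apply/seteqP; split => x /=; rewrite !in_itv/=; lra.
rewrite measureU//=; last first.
  apply/seteqP; split => // x [] /=; rewrite !in_itv/= andbT => /andP[_ xb].
  by rewrite leNgt xb.
by rewrite -[ltLHS]add0e lteD2rE ?fin_num_measure// normal_prob_itv_gt0.
Qed.

End normal_laws.

(** * Expectation of a product of independent factors *)

Section independence.
Local Open Scope ereal_scope.
Context {R : realType} {d d1 d2 : measure_display} {Om : measurableType d}
  {T1 : measurableType d1} {T2 : measurableType d2}.

(** Independence says that the joint law of X and Z is the product of their
    laws, so this is Fubini--Tonelli.  The values of X may lie in any measurable
    space: taking for X the identity into the same set with a smaller
    sigma-algebra G gives independence of Z from G. *)
Lemma ge0_integral_mul_indep (P : probability Om R)
    (X : {mfun Om >-> T1}) (Z : {mfun Om >-> T2})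
    (f : T1 -> \bar R) (g : T2 -> \bar R) :
  (forall A B, measurable A -> measurable B ->
    P (X @^-1` A `&` Z @^-1` B) = P (X @^-1` A) * P (Z @^-1` B)) ->
  measurable_fun setT f -> (forall x, 0 <= f x) ->
  measurable_fun setT g -> (forall y, 0 <= g y) ->
  \int[P]_w (f (X w) * g (Z w)) = \int[P]_w f (X w) * \int[P]_w g (Z w).
Proof.
move=> XZ mf f0 mg g0.
have mXZ : measurable_fun setT (fun w => (X w, Z w)).
  by apply/measurable_fun_pair; exact: measurable_funP.
pose mXZ_mixin := isMeasurableFun.Build _ _ _ _ _ mXZ.
pose J : {mfun Om >-> (T1 * T2)%type} :=
  HB.pack (fun w => (X w, Z w)) mXZ_mixin.
have mfst : measurable_fun setT (fun z : (T1 * T2)%type => f z.1).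
  exact: measurableT_comp.
have msnd : measurable_fun setT (fun z : (T1 * T2)%type => g z.2).
  exact: measurableT_comp.
have mfg : measurable_fun setT (fun z : (T1 * T2)%type => f z.1 * g z.2).
  exact: emeasurable_funM.
have fg0 (z : (T1 * T2)%type) : 0 <= f z.1 * g z.2 by exact: mule_ge0.
transitivity (\int[distribution P J]_z (f z.1 * g z.2)).
  by rewrite ge0_integral_distribution.
transitivity (\int[distribution P X \x distribution P Z]_z (f z.1 * g z.2)).
  apply: eq_measure_integral => A mA _; apply/esym/product_measure_unique => //.
rewrite fubini_tonelli1//= /fubini_F/=.
under eq_integral do rewrite ge0_integralZl//.
rewrite ge0_integralZr//; last exact: integral_ge0.
by rewrite !ge0_integral_distribution.
Qed.

End independence.

Lemma measurable_expR_affine {R : realType} d (X : measurableType d)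
    (a b : R) (D : set X) (f : X -> R) :
  measurable_fun D f -> measurable_fun D (fun x => expR (a * f x - b)).
Proof.
move=> mf; apply: measurableT_comp => //.
by apply: measurable_funB => //; exact: measurable_funM.
Qed.

(** * Girsanov's theorem for a constant drift *)

Section girsanov.
Local Open Scope ereal_scope.
Context {R : realType} {d : measure_display} {Om : measurableType d}.
Variables (P : probability Om R) (T l : R).
Variables (F : R -> set_system Om) (W : R -> Om -> R).
Hypothesis F_sigma_algebra : forall t, sigma_algebra setT (F t).
Hypothesis F_mono : forall s t, (s <= t)%R -> F s `<=` F t.
Hypothesis F_measurable : F T `<=` measurable.
Hypothesis W_brownian : brownian_motion T F P W.

(* Om with the sub-sigma-algebra F t; F t-measurability of a function is its
   measurability on this space. *)
Let Fspace t : measurableType _ := g_sigma_algebraType (F t).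

Let measurable_FspaceE t : (@measurable _ (Fspace t) : set_system Om) = F t.
Proof. exact: sigma_algebra_id. Qed.

Let F_measurable_le t : (t <= T)%R -> F t `<=` measurable.
Proof. by move=> tT; apply: subset_trans F_measurable; exact: F_mono. Qed.

Let measurable_W s t : (0 <= s <= t)%R -> (t <= T)%R ->
  measurable_fun [set: Fspace t] (W s : Fspace t -> R).
Proof.
move=> /andP[s0 st] tT _ V mV; rewrite setTI measurable_FspaceE.
apply: (F_mono st); case: W_brownian => + _ _ _ _; apply => //.
by rewrite s0 (le_trans st tT).
Qed.

Let measurable_Fspace d' (T' : measurableType d') t (f : Om -> T') :
  (t <= T)%R ->
  measurable_fun [set: Fspace t] (f : Fspace t -> T') ->
  measurable_fun [set: Om] f.
Proof.
move=> tT mf _ V mV; apply: (F_measurable_le tT).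
by rewrite -measurable_FspaceE; exact: mf.
Qed.

Let measurable_idF t : (t <= T)%R ->
  measurable_fun [set: Om] (idfun : Om -> Fspace t).
Proof. by move=> tT; exact: measurable_Fspace (@measurable_id _ _ _). Qed.

(** The stochastic exponential of l W, a martingale under P
    ([integral_exp_martingale]) that starts at exp(l W_0) = 1. *)
Definition exp_martingale t w := expR (l * W t w - l ^+ 2 / 2 * t).

Let incr s t : Om -> R := (W t \- W s)%R.

(** The one computation behind Girsanov's theorem: Y is F_s-measurable, hence
    independent of Z = W_t - W_s, and integrating the tilted factor against the
    law N(0, t - s) of Z gives the same law for Z - l (t - s).  With V = setT it
    says that the exponential factor has conditional expectation 1. *)
Lemma integral_tilted_increment s t (Y : Om -> \bar R) (V : set R) :
  (0 <= s < t)%R -> (t <= T)%R ->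
  measurable_fun [set: Fspace s] (Y : Fspace s -> \bar R) ->
  (forall w, 0 <= Y w) -> measurable V ->
  \int[P]_w (Y w * (expR (l * incr s t w - l ^+ 2 / 2 * (t - s)) *
                    \1_V (incr s t w - l * (t - s)))%:E) =
  \int[P]_w Y w * normal_prob 0 (Num.sqrt (t - s)) V.
Proof.
move=> /andP[s0 st] tT mY Y0 mV.
have sT : (s <= T)%R by rewrite (le_trans (ltW st)).
have t0 : (0 <= t)%R by rewrite (le_trans s0)// ltW.
have mincr : @measurable_fun _ _ Om (measurableTypeR R) setT (incr s t).
  apply: (@measurable_funB _ _ R setT); apply: (measurable_Fspace tT).
    by apply: measurable_W => //; rewrite lexx t0.
  by apply: measurable_W => //; rewrite s0 ltW.
pose X : {mfun Om >-> Fspace s} :=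
  HB.pack (idfun : Om -> Fspace s)
    (isMeasurableFun.Build _ _ _ _ _ (measurable_idF sT)).
pose Z : {mfun Om >-> measurableTypeR R} :=
  HB.pack (incr s t) (isMeasurableFun.Build _ _ _ _ _ mincr).
pose g (z : measurableTypeR R) := (expR (l * z - l ^+ 2 / 2 * (t - s)) *
   \1_V (z - l * (t - s)))%:E.
have mg : measurable_fun setT g.
  apply/measurable_EFinP; apply: measurable_funM.
    exact: (measurable_expR_affine _ _ (@measurable_id _ _ _)).
  have mind : measurable_fun setT (\1_V : R -> R) by exact: measurable_indic.
  have mshift : measurable_fun setT (fun z : R => z - l * (t - s))%R.
    exact: measurable_funB.
  exact: (measurableT_comp mind mshift).
rewrite (ge0_integral_mul_indep (X := X) (Z := Z) (f := Y) (g := g)) //;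
  last 2 first.
- move=> A B mA mB; have [_ _ _ ind _] := W_brownian.
  apply: (ind s t A B) => //; first by rewrite s0.
  by rewrite -measurable_FspaceE.
- by move=> z; rewrite lee_fin mulr_ge0// expR_ge0.
congr (_ * _).
transitivity (\int[distribution P Z]_z g z).
  rewrite ge0_integral_distribution// => z.
  by rewrite lee_fin mulr_ge0// expR_ge0.
rewrite (eq_measure_integral (normal_prob 0 (Num.sqrt (t - s)))); last first.
  move=> A mA _; have [_ _ _ _ law] := W_brownian.
  by apply: (law s t A) => //; rewrite s0.
rewrite -(@integral_expR_normal_prob _ l) ?subr_gt0//.
rewrite [RHS]integral_mkcond; apply: eq_integral => z _.
have -> : g z = (expR (l * z - l ^+ 2 / 2 * (t - s)) *
    (z \in (fun x => x - l * (t - s))%R @^-1` V)%:R)%:E by [].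
by rewrite patchE; case: ifPn; rewrite ?mulr1 ?mulr0.
Qed.

Let integral_indicE (A : set Om) (f : Om -> R) :
  \int[P]_(w in A) (f w)%:E = \int[P]_w (f w * \1_A w)%:E.
Proof.
rewrite integral_mkcond; apply: eq_integral => w _.
by rewrite patchE indicE; case: ifPn; rewrite ?mulr1 ?mulr0.
Qed.

Let measurable_exp_martingale t : (0 <= t <= T)%R ->
  measurable_fun [set: Om] (exp_martingale t).
Proof.
move=> /andP[t0 tT]; apply: measurable_expR_affine.
apply: (measurable_Fspace tT).
by apply: measurable_W => //; rewrite t0 lexx.
Qed.

Let measurable_martingale_indic t A : (0 <= t <= T)%R -> F t A ->
  measurable_fun [set: Fspace t]
    ((fun w => (exp_martingale t w * \1_A w)%:E) : Fspace t -> \bar R).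
Proof.
move=> /andP[t0 tT] FA; apply/measurable_EFinP; apply: measurable_funM.
  apply: (@measurable_expR_affine _ _ (Fspace t)).
  by apply: measurable_W => //; rewrite t0 lexx.
by apply: (@measurable_indic _ (Fspace t)); rewrite measurable_FspaceE.
Qed.

(** The martingale property on [t, T], from [integral_tilted_increment] with
    V = setT. *)
Lemma integral_exp_martingale t (A : set Om) : (0 <= t <= T)%R -> F t A ->
  \int[P]_(w in A) (exp_martingale T w)%:E =
  \int[P]_(w in A) (exp_martingale t w)%:E.
Proof.
move=> /andP[t0]; rewrite le_eqVlt => /predU1P[-> //|tT] FA.
have tT' : (0 <= t <= T)%R by rewrite t0 ltW.
rewrite !(integral_indicE A) -[RHS]mule1.
rewrite -(probability_setT (normal_prob 0 (Num.sqrt (T - t)))).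
rewrite -integral_tilted_increment ?t0//; last 2 first.
- exact: measurable_martingale_indic.
- by move=> w; rewrite lee_fin mulr_ge0// expR_ge0.
apply: eq_integral => w _; rewrite indicT mulr1 -EFinM.
rewrite mulrAC -expRD; congr (expR _ * _)%:E.
by rewrite /incr /=; ring.
Qed.

Variable Q : {measure set Om -> \bar R}.
Hypothesis QE : forall A, measurable A ->
  Q A = \int[P]_(w in A) (exp_martingale T w)%:E.

Let B t w : R := W t w - l * t.

(** Since A and the increment both belong to F_t, the density D_T may be
    replaced by D_t, which is D_s times the exponential factor of the increment
    W_t - W_s; [integral_tilted_increment] then separates D_s on A from the
    increment. *)
Lemma girsanov_increment s t (A : set Om) (V : set R) :
  (0 <= s < t)%R -> (t <= T)%R -> F s A -> measurable V ->
  Q (A `&` (B t \- B s)%R @^-1` V) = Q A * normal_prob 0 (Num.sqrt (t - s)) V.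
Proof.
move=> /andP[s0 st] tT FA mV.
have sT : (0 <= s <= T)%R by rewrite s0 (le_trans (ltW st)).
have t0T : (0 <= t <= T)%R by rewrite tT (le_trans s0)// ltW.
have BV : F t ((B t \- B s)%R @^-1` V).
  rewrite -measurable_FspaceE -[X in measurable X]setTI.
  apply: (@measurable_funB _ (Fspace t)) => //;
    apply: (@measurable_funB _ (Fspace t)) => //; apply: measurable_W => //.
    by rewrite lexx; case/andP : t0T => ->.
  by rewrite s0 ltW.
have FAB : F t (A `&` (B t \- B s)%R @^-1` V).
  rewrite -measurable_FspaceE; apply: measurableI; rewrite measurable_FspaceE//.
  exact: F_mono (ltW st) _ FA.
have mA : measurable A by case/andP : sT => _ /F_measurable_le; exact.
have mAB := F_measurable_le tT FAB.
rewrite (QE mA) (QE mAB).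
rewrite (integral_exp_martingale t0T FAB) (integral_exp_martingale sT FA).
rewrite (integral_indicE (A `&` _)) (integral_indicE A).
rewrite -integral_tilted_increment ?s0//; last 2 first.
- exact: measurable_martingale_indic.
- by move=> w; rewrite lee_fin mulr_ge0// expR_ge0.
apply: eq_integral => w _; rewrite -EFinM indicI /=.
have -> : (incr s t w - l * (t - s))%R = (B t \- B s)%R w.
  by rewrite /incr /B /=; ring.
rewrite -[\1_V _]/(\1_((B t \- B s)%R @^-1` V) w) mulrACA -expRD.
congr (expR _ * _)%:E.
by rewrite /incr /=; ring.
Qed.

(** By the martingale property the mass of Q is the expectation of
    D_0 = exp(l W_0), and W_0 = 0 almost surely. *)
Lemma girsanov_mass : (0 <= T)%R -> Q setT = 1.
Proof.
move=> T0; have FT : F 0 setT.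
  by rewrite -measurable_FspaceE; exact: measurableT.
rewrite QE// (integral_exp_martingale (t := 0%R)) ?lexx//.
rewrite -(probability_setT P) -[RHS]mul1e -integral_cst//.
apply: ae_eq_integral => //.
- by apply/measurable_EFinP; apply: measurable_exp_martingale; rewrite lexx.
- case: W_brownian => _ + _ _ _; apply: filterS => w W0 _.
  by rewrite /exp_martingale W0 !mulr0 subr0 expR0.
Qed.

(** Q is absolutely continuous with respect to P, so the almost sure properties
    of W carry over; the law and the independence of the increments are
    [girsanov_increment], for A = setT and for A in F_s. *)
Lemma girsanov_constant_drift : (0 <= T)%R ->
  brownian_motion T F Q (fun t w => W t w - l * t)%R.
Proof.
move=> T0; have FT s : F s setT.
  by rewrite -measurable_FspaceE; exact: measurableT.
have Qac N : P.-negligible N -> Q.-negligible N.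
  move=> [M [mM PM NM]]; exists M; split => //; rewrite QE//.
  apply: null_set_integral => //; apply/measurable_EFinP/measurable_funTS.
  by apply: measurable_exp_martingale; rewrite lexx T0.
have law s t (V : set R) : (0 <= s < t)%R -> (t <= T)%R -> measurable V ->
    Q ((B t \- B s)%R @^-1` V) = normal_prob 0 (Num.sqrt (t - s)) V.
  move=> s0t tT mV; rewrite -[X in Q X]setTI girsanov_increment//.
  by rewrite girsanov_mass// mul1e.
have [adapted W0 cW _ _] := W_brownian; split.
- move=> t V /andP[t0 tT] mV.
  rewrite -measurable_FspaceE -[X in measurable X]setTI.
  have mWt : measurable_fun [set: Fspace t] (W t : Fspace t -> R).
    by apply: measurable_W => //; rewrite t0 lexx.
  exact: (measurable_funB mWt (@measurable_cst _ _ _ _ _ _)).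
- apply: Qac; apply: negligibleS W0 => w /= + W0; apply.
  by rewrite W0 mulr0 subr0.
- apply: Qac; apply: negligibleS cW => w /= + cWw; apply => x.
  apply: continuousB; first exact: cWw.
  by apply: continuous_subspaceT => y; exact: mulrl_continuous.
- move=> s t A V s0t tT FA mV.
  by rewrite girsanov_increment// law.
- exact: law.
Qed.

End girsanov.

(** * Independence from an event, rays and limits *)

Section independence_limit.
Local Open Scope ereal_scope.
Context {R : realType} {d : measure_display} {Om : measurableType d}.
Variable P : probability Om R.

(** Both sides are finite measures in V that agree on rays. *)
Lemma independence_from_rays (A : set Om) (Z : Om -> R) :
  measurable A -> measurable_fun setT Z ->
  (forall a : R, P (A `&` Z @^-1` `]a, +oo[) = P A * P (Z @^-1` `]a, +oo[)) ->
  forall V, measurable V -> P (A `&` Z @^-1` V) = P A * P (Z @^-1` V).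
Proof.
move=> mA mZ rays V mV.
have mZ' : @measurable_fun _ _ Om (measurableTypeR R) setT Z by exact: mZ.
have PA0 : (0 <= fine (P A))%R by rewrite fine_ge0.
pose m1 := (pushforward (mrestr P mA) (Z : Om -> measurableTypeR R) :
  {measure set _ -> \bar R}).
pose m2 := (pushforward (mscale (NngNum PA0) P) (Z : Om -> measurableTypeR R) :
  {measure set _ -> \bar R}).
have m1E U : m1 mZ' U = P (A `&` Z @^-1` U).
  by rewrite /m1 /= /pushforward /mrestr setIC.
have m2E U : m2 mZ' U = P A * P (Z @^-1` U).
  by rewrite /m2 /= /pushforward /mscale /= fineK// fin_num_measure.
rewrite -m1E -m2E; apply: measure_ray_unique => //.
  rewrite m1E preimage_setT setIT.
  exact: le_lt_trans (probability_le1 _ _) (ltry 1).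
by move=> a; rewrite m1E m2E rays.
Qed.

(** The indicator of the ray is continuous except at a, a value that Z avoids
    almost surely, so dominated convergence applies. *)
Lemma cvg_probability_ray (A : set Om) (Zn : nat -> Om -> R) (Z : Om -> R)
    (a : R) :
  measurable A -> (forall n, measurable_fun setT (Zn n)) ->
  measurable_fun setT Z ->
  {ae P, forall w, Zn ^~ w @ \oo --> Z w} ->
  P (Z @^-1` [set a]) = 0 ->
  P (A `&` Zn n @^-1` `]a, +oo[) @[n --> \oo] --> P (A `&` Z @^-1` `]a, +oo[).
Proof.
move=> mA mZn mZ ZnZ Za0.
have mpre Y : measurable_fun setT Y -> measurable (Y @^-1` `]a, +oo[ : set Om).
  by move=> mY; rewrite -[X in measurable X]setTI; exact: mY.
have PE Y : measurable_fun setT Y -> P (A `&` Y @^-1` `]a, +oo[) =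
    \int[P]_(w in A) (\1_(`]a, +oo[ : set R) (Y w))%:E.
  by move=> mY; rewrite setIC -integral_indic//; exact: mpre.
rewrite PE//; under eq_fun do rewrite PE//.
have mind Y : measurable_fun setT Y ->
    measurable_fun A (fun w => (\1_(`]a, +oo[ : set R) (Y w))%:E).
  move=> mY; apply/measurable_EFinP/measurable_funTS.
  by apply: measurableT_comp mY; exact: measurable_indic.
have aeZa : {ae P, forall w, Z w <> a}.
  have : P.-negligible (Z @^-1` [set a]).
    apply/negligibleP => //; rewrite -[X in measurable X]setTI; exact: mZ.
  by apply: negligibleS => w /= /contrapT.
have [] := @dominated_convergence _ _ _ P A mA
  (fun n w => (\1_(`]a, +oo[ : set R) (Zn n w))%:E)
  (fun w => (\1_(`]a, +oo[ : set R) (Z w))%:E) (cst 1) => //.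
- by move=> n; exact: mind.
- exact: mind.
- near=> w => _; apply: cvg_near_cst.
  have ZnZw : Zn ^~ w @ \oo --> Z w by near: w.
  have /eqP Zwa : Z w <> a by near: w.
  have [Zwlta|altZw|Zweqa] := ltgtP (Z w) a; last by rewrite Zweqa eqxx in Zwa.
  + near=> n; have Znlta : (Zn n w < a)%R.
      by near: n; exact: @cvgr_lt _ _ _ _ _ _ ZnZw _ Zwlta.
    rewrite !indicE !memNset//= in_itv/= andbT;
      by apply/negP; rewrite -leNgt ltW.
  + near=> n; have altZn : (a < Zn n w)%R.
      by near: n; exact: @cvgr_gt _ _ _ _ _ _ ZnZw _ altZw.
    by rewrite !indicE !mem_set//= in_itv/= andbT.
- by apply: finite_measure_integrable_cst.
- apply: aeW => w n _; rewrite /= lee_fin indicE.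
  by case: (_ \in _); rewrite ?normr1 ?normr0.
Unshelve. all: end_near. Qed.

End independence_limit.

(** * The usual augmentation preserves the Brownian motion *)

Lemma measure_eq_negligible_symdiff {R : realType} d (X : measurableType d)
    (mu : {measure set X -> \bar R}) (A B : set X) :
  measurable A -> measurable B ->
  mu.-negligible ((A `\` B) `|` (B `\` A)) -> mu A = mu B.
Proof.
wlog suff : A B / measurable A -> measurable B ->
    mu.-negligible ((A `\` B) `|` (B `\` A)) -> (mu A <= mu B)%E.
  move=> le_mu mA mB AB; apply/eqP; rewrite eq_le !le_mu//.
  by rewrite setUC.
move=> mA mB AB.
have mAB : measurable (A `\` B) by exact: measurableD.
have AB0 : mu (A `\` B) = 0%E.
  by apply: measure_negligible => //; apply: negligibleS AB; exact: subsetUl.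
rewrite -[leRHS]adde0 -AB0; apply: le_trans (measureU2 _ mB mAB).
apply: le_measure; rewrite ?inE//; first exact: measurableU.
by move=> x Ax; have [Bx|Bx] := pselect (B x); [left|right].
Qed.

Section augmentation.
Context {R : realType} (T : R) (P0 : probability (raw_space T) R).

Let raw_completion s := <<s raw_filtration T s `|` P0.-negligible >>.

Lemma augmented_filtration_sigma_algebra t :
  sigma_algebra setT (augmented_filtration P0 t).
Proof.
by apply: sigma_algebra_bigcap => s _; exact: smallest_sigma_algebra.
Qed.

Lemma augmented_filtration_mono s t : s <= t ->
  augmented_filtration P0 s `<=` augmented_filtration P0 t.
Proof.
move=> st A As r [/andP[tr rT]|rT]; apply: As; [left|by right].
by rewrite (le_lt_trans st tr).
Qed.

Lemma augmented_filtration_measurable :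
  augmented_filtration P0 T `<=` (@measurable _ (augmented_space P0)).
Proof. exact: sub_sigma_algebra. Qed.

Lemma raw_filtration_mono s t : s <= t ->
  raw_filtration T s `<=` raw_filtration T t.
Proof.
move=> st; apply: sub_sigma_algebra2 => A [r /andP[r0 rs] rV].
by exists r => //; rewrite r0 (le_trans rs).
Qed.

Lemma raw_filtration_augmented t : t <= T ->
  raw_filtration T t `<=` augmented_filtration P0 t.
Proof.
move=> tT A rA s ts; apply: sub_sigma_algebra; left.
apply: raw_filtration_mono rA.
by case: ts => [/andP[/ltW]|->].
Qed.

Lemma raw_measurable_augmented (A : set (path_space T)) :
  @measurable _ (raw_space T) A -> @measurable _ (augmented_space P0) A.
Proof.
move=> mA; apply: augmented_filtration_measurable.
exact: raw_filtration_augmented.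
Qed.

Lemma augmented_measureE (A : set (path_space T)) :
  @measurable _ (raw_space T) A -> @augmented_measure R T P0 A = P0 A.
Proof. exact: (@measurable_mu_extE _ _ (raw_space T)). Qed.

Lemma augmented_negligible (N : set (path_space T)) :
  P0.-negligible N -> (@augmented_measure R T P0).-negligible N.
Proof.
move=> [M [mM M0 NM]]; exists M; split => //.
  exact: raw_measurable_augmented.
by rewrite -M0; exact: augmented_measureE.
Qed.

(** The sets that equal a raw set up to a null set form a sigma-algebra that
    contains the raw sets and the null sets. *)
Lemma raw_completion_approx s (A : set (path_space T)) : raw_completion s A ->
  exists2 A', raw_filtration T s A' &
    P0.-negligible ((A `\` A') `|` (A' `\` A)).
Proof.
pose approximable : set_system (path_space T) := [set A | exists2 A',
  raw_filtration T s A' & P0.-negligible ((A `\` A') `|` (A' `\` A))].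
suff : raw_completion s `<=` approximable by apply.
apply: smallest_sub => {A}; last first.
  move=> A [rA|nA].
    by exists A => //; rewrite !setDv setU0; exact: negligible_set0.
  exists set0; first exact: sigma_algebra0.
  by rewrite set0D setU0 setD0.
split.
- exists set0; first exact: sigma_algebra0.
  by rewrite !setDv setU0; exact: negligible_set0.
- move=> A [A' rA' AA']; exists (~` A'); first exact: sigma_algebraC.
  rewrite setTD; apply: negligibleS AA' => w.
  move=> [[Aw /contrapT A'w]|[A'w /contrapT Aw]].
    by right.
  by left.
- move=> A approxA.
  have /choice[A' AA'] n : exists A', raw_filtration T s A' /\
      P0.-negligible ((A n `\` A') `|` (A' `\` A n)).
    by have [A' rA' AA'] := approxA n; exists A'.
  exists (\bigcup_n A' n).
    by apply: sigma_algebra_bigcup => n; have [] := AA' n.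
  have : P0.-negligible (\bigcup_n ((A n `\` A' n) `|` (A' n `\` A n))).
    by apply: negligible_bigcup => n; have [] := AA' n.
  apply: negligibleS => w [[[n _ Anw] A'w]|[[n _ A'nw] Aw]]; exists n => //.
    by left; split => // A'nw; apply: A'w; exists n.
  by right; split => // Anw; apply: Aw; exists n.
Qed.

Let P := @augmented_measure R T P0.

Lemma augmented_measure_approx s (A : set (path_space T)) : s <= T ->
  raw_completion s A ->
  exists2 A', raw_filtration T s A' &
    forall E, @measurable _ (raw_space T) E -> P (A `&` E) = P0 (A' `&` E).
Proof.
move=> sT cA; have [A' rA' AA'] := raw_completion_approx cA.
have mA' : @measurable _ (raw_space T) A' by exact: raw_filtration_mono rA'.
have mA : @measurable _ (augmented_space P0) A.
  apply: augmented_filtration_measurable => r [/andP[/lt_le_trans/[apply]]|->].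
    by rewrite ltxx.
  apply: sub_sigma_algebra2 cA => B [rB|nB]; [left|by right].
  exact: raw_filtration_mono rB.
exists A' => // E mE.
have mA'E : @measurable _ (raw_space T) (A' `&` E) by exact: measurableI.
rewrite -augmented_measureE//.
apply: measure_eq_negligible_symdiff.
- by apply: measurableI => //; exact: raw_measurable_augmented.
- exact: raw_measurable_augmented.
- apply: negligibleS (augmented_negligible AA') => w.
  move=> [[[Aw Ew] A'Ew]|[[A'w Ew] AEw]].
    by left; split => // A'w; apply: A'Ew.
  by right; split => // Aw; apply: AEw.
Qed.

Local Open Scope ereal_scope.

Hypothesis wienerP0 : wiener_measure P0.

Let W := @coordinate R T.
Let incr s t : path_space T -> R := (W t \- W s)%R.

Lemma measurable_coordinate t : (0 <= t <= T)%R ->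
  measurable_fun [set: raw_space T] (W t : raw_space T -> R).
Proof.
move=> tT _ V mV; rewrite setTI; apply: sub_sigma_algebra.
by exists t => //; exists V.
Qed.

Let measurable_incr s t : (0 <= s < t)%R -> (t <= T)%R ->
  measurable_fun [set: raw_space T] (incr s t : raw_space T -> R).
Proof.
move=> /andP[s0 st] tT.
have mWt : measurable_fun [set: raw_space T] (W t : raw_space T -> R).
  by apply: measurable_coordinate; rewrite tT (le_trans s0)// ltW.
have mWs : measurable_fun [set: raw_space T] (W s : raw_space T -> R).
  by apply: measurable_coordinate; rewrite s0 (le_trans (ltW st)).
exact: measurable_funB mWt mWs.
Qed.

Let raw_indep s t A (V : set R) : (0 <= s < t)%R -> (t <= T)%R ->
  raw_completion s A -> measurable V ->
  P (A `&` incr s t @^-1` V) = P A * P (incr s t @^-1` V).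
Proof.
move=> s0t tT cA mV.
have sT : (s <= T)%R by case/andP : s0t => _ /ltW/le_trans; apply.
have [A' rA' AE] := augmented_measure_approx sT cA.
have mI : @measurable _ (raw_space T) (incr s t @^-1` V).
  by rewrite -[X in measurable X]setTI; exact: measurable_incr.
have PA : P A = P0 A' by rewrite -[A]setIT AE ?setIT//; exact: measurableT.
have PI : P (incr s t @^-1` V) = P0 (incr s t @^-1` V).
  exact: augmented_measureE.
rewrite AE// PA PI.
by have [_ _ _ + _] := wienerP0; exact.
Qed.

(** A belongs to the completion at every time s_n > s, so it is independent of
    the increments over [s_n, t].  For the event that the increment exceeds a,
    both sides of the product rule over [s_n, t] converge to those over [s, t]
    as s_n decreases to s ([cvg_probability_ray], also applied to the whole
    space). *)
Lemma augmented_independence s t A (V : set R) :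
  (0 <= s < t)%R -> (t <= T)%R ->
  augmented_filtration P0 s A -> measurable V ->
  P (A `&` incr s t @^-1` V) = P A * P (incr s t @^-1` V).
Proof.
move=> s0t tT FA mV; have /andP[s0 st] := s0t.
have sT : (s <= T)%R by rewrite (le_trans (ltW st)).
have mA : @measurable _ (augmented_space P0) A.
  apply: augmented_filtration_measurable.
  exact: augmented_filtration_mono FA.
have mI r : (0 <= r < t)%R ->
    measurable_fun [set: augmented_space P0]
      (incr r t : augmented_space P0 -> R).
  move=> r0t _ U mU; apply: raw_measurable_augmented.
  exact: measurable_incr.
apply: (@independence_from_rays _ _ _ P A (incr s t)) => //; first exact: mI.
move=> a.
(* The index shift n.+2 keeps the sequence strictly below t. *)
pose sn n : R := (s + (t - s) / n.+2%:R)%R.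
have ssn n : (s < sn n < t)%R.
  rewrite ltrDl divr_gt0 ?subr_gt0//= -ltrBrDl.
  by rewrite ltr_pdivrMr// ltr_pMr ?subr_gt0// ltr1n.
have sn0t n : (0 <= sn n < t)%R.
  by have /andP[ssn' ->] := ssn n; rewrite andbT (le_trans s0)// ltW.
have sns : sn n @[n --> \oo] --> s.
  rewrite -[X in _ --> X]addr0; apply: cvgD; first exact: cvg_cst.
  rewrite -(mulr0 (t - s)%R); apply: cvgM; first exact: cvg_cst.
  by have := @cvg_harmonic R; rewrite -cvg_shiftS.
have ae_cvg : {ae P, forall w, incr (sn n) t w @[n --> \oo] --> incr s t w}.
  have [_ _ cW _ _] := wienerP0.
  have : {ae P, forall w, {within `[0%R, T], continuous (W ^~ w)}}.
    exact: augmented_negligible cW.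
  apply: negligibleS => w /= + cWw; apply.
  apply: (@cvgB _ R); first exact: cvg_cst.
  have := cWw s; rewrite /continuous_at /nbhs/= -nbhs_subspace_in; last first.
    by rewrite /= in_itv/= s0.
  apply: cvg_comp => U /sns snU.
  suff : \forall n \near \oo, U (sn n) by [].
  near=> n; have : `[0%R, T]%classic (sn n) -> U (sn n) by near: n; exact: snU.
  apply; rewrite /= in_itv/=; have /andP[-> /ltW/le_trans->//] := sn0t n.
have law0 : P (incr s t @^-1` [set a]) = 0.
  have [_ _ _ _ law] := wienerP0.
  transitivity (P0 (incr s t @^-1` [set a])).
    apply: augmented_measureE; rewrite -[X in measurable X]setTI.
    exact: measurable_incr.
  by rewrite [LHS]law// normal_prob1.
have cvgI B (mB : measurable B) :=
  @cvg_probability_ray _ _ _ P B (fun n => incr (sn n) t) (incr s t) a mB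
    (fun n => mI _ (sn0t n)) (mI _ s0t) ae_cvg law0.
have cvgA := cvgI A mA; have cvgT := cvgI setT measurableT.
rewrite setTI in cvgT.
have PA : P A \is a fin_num by rewrite fin_num_measure.
have cvgB := cvgeZl PA cvgT.
apply: (cvg_unique _ cvgA) => //; apply: cvg_trans cvgB.
apply: near_eq_cvg; apply: nearW => n /=.
rewrite setTI; apply/esym/raw_indep => //.
by apply: FA; left; have /andP[-> /ltW/le_trans->] := ssn n.
Unshelve. all: end_near. Qed.

Lemma augmented_brownian_motion :
  @brownian_motion R T _ (augmented_space P0) (augmented_filtration P0) P W.
Proof.
have [_ W0 cW _ law] := wienerP0; split.
- move=> t V /andP[t0 tT] mV; apply: raw_filtration_augmented => //.
  by apply: sub_sigma_algebra; exists t; [rewrite t0 lexx|exists V].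
- exact: augmented_negligible W0.
- exact: augmented_negligible cW.
- by move=> s t A V s0t tT FA mV; exact: augmented_independence.
- move=> s t V s0t tT mV; rewrite -law//; apply: augmented_measureE.
  by rewrite -[X in measurable X]setTI; exact: measurable_incr.
Qed.

End augmentation.

(** * Drifted paths and the theorem *)

Lemma continuous_drifted_path (R : realType) (T l : R) (w : path_space T) :
  continuous (fun x : `[0, T]%classic => w x - l * set_val x).
Proof.
move=> x; have cw : w y @[y --> x] --> w x.
  exact: (@cts_fun _ _ (w : continuousType (`[0, T]%classic : set R) R)).
have cval : (set_val y : R) @[y --> x] --> set_val x.
  exact: (@initial_continuous _ R set_val).
exact: (cvgB cw (cvgM (cvg_cst l) cval)).
Qed.

Lemma drifted_path (R : realType) (T l : R) (w : path_space T) :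
  exists y : path_space T,
    forall s, 0 <= s <= T -> coordinate s y = coordinate s w - l * s.
Proof.
pose y : path_space T := HB.pack
  (fun x : `[0, T]%classic => w x - l * set_val x)
  (isContinuous.Build _ _ _ (@continuous_drifted_path R T l w)).
exists y => s sT; rewrite /coordinate.
have sT' : s \in `[0, T]%classic by rewrite inE/= in_itv.
by rewrite (insubT (fun s => s \in `[0, T]%classic) sT').
Qed.

Theorem mainTheorem1 (R : realType) (T : R) (P0 : probability (raw_space T) R) :
  0 < T -> wiener_measure P0 ->
  let xi : path_space T -> R -> R := fun _ _ => 0 in
  [/\ progressive_functional xi,
      forall lambda : R,
        candidate_measure_with xi (@tilted_measure R T P0 lambda)
          (fun t w => coordinate t w - lambda * t) &
      exists Q1 Q2 : {measure set (augmented_space P0) -> \bar R},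
        [/\ candidate_measure xi Q1, candidate_measure xi Q2 &
            exists2 A, measurable A & Q1 A <> Q2 A]].
Proof.
move=> T0 wP0 xi.
have F_sigma := @augmented_filtration_sigma_algebra R T P0.
have F_mono := @augmented_filtration_mono R T P0.
have F_meas := @augmented_filtration_measurable R T P0.
have W_bm := augmented_brownian_motion wP0.
have QE lambda (A : set (augmented_space P0)) : measurable A ->
  @tilted_measure R T P0 lambda A = (\int[@augmented_measure R T P0]_(w in A)
    (@exp_martingale R _ (augmented_space P0) lambda
       (@coordinate R T) T w)%:E)%E by [].
have bm lambda := @girsanov_constant_drift R _ (augmented_space P0)
  (@augmented_measure R T P0) T lambda _ _ F_sigma F_mono F_meas W_bm _
  (QE lambda) (ltW T0).
have mass1 lambda := @girsanov_mass R _ (augmented_space P0)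
  (@augmented_measure R T P0) T lambda _ _ F_sigma F_mono F_meas W_bm _
  (QE lambda) (ltW T0).
have candidate lambda :
  candidate_measure_with xi (@tilted_measure R T P0 lambda)
    (fun t w => coordinate t w - lambda * t).
  split; [exact: mass1|exact: bm|].
  apply: aeW => w t /andP[t0 tT] _.
  have [y yE] := drifted_path lambda w; exists y; split => // s /andP[s0 st].
  by rewrite /Rintegral integral0_eq// addr0 yE// s0 (le_trans st).
split; [by move=> t tT; exact: measurable_cst|exact: candidate|].
exists (@tilted_measure R T P0 0), (@tilted_measure R T P0 1).
split; [by eexists; exact: candidate|by eexists; exact: candidate|].
have T00 : (0 : R) <= 0 < T by rewrite lexx.
(* Under P^lambda the increment W_T - W_0 has law N(lambda T, T). *)
pose rise : set (path_space T) :=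
  (coordinate T \- coordinate 0) @^-1` `[T, +oo[%classic.
pose N V := normal_prob 0 (Num.sqrt (T - 0)) V.
have Q0_rise : @tilted_measure R T P0 0 rise = N `[T, +oo[%classic.
  have [_ _ _ _ law] := bm 0; rewrite /N -(law 0 T)//.
  by congr (tilted_measure _ _); apply/funext => w /=; rewrite !mul0r !subr0.
have Q1_rise : @tilted_measure R T P0 1 rise = N `[0, +oo[%classic.
  have [_ _ _ _ law] := bm 1; rewrite /N -(law 0 T)//.
  congr (tilted_measure _ _); apply/funext => w /=.
  by apply/propext; rewrite /rise /= !in_itv/= !andbT; split; lra.
exists rise.
  apply: raw_measurable_augmented; rewrite -[X in measurable X]setTI.
  have mT : measurable_fun [set: raw_space T] (coordinate T : raw_space T -> R).
    by apply: measurable_coordinate; rewrite lexx ltW.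
  have m0 : measurable_fun [set: raw_space T] (coordinate 0 : raw_space T -> R).
    by apply: measurable_coordinate; rewrite lexx ltW.
  exact: measurable_funB mT m0 _ _ (measurable_itv _).
apply/eqP; rewrite lt_eqF// [ltLHS]Q0_rise [ltRHS]Q1_rise.
by apply: normal_prob_ray_lt; rewrite ?gt_eqF// sqrtr_gt0 subr0.
Qed.
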